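(* For all sufficiently large $n$ there is a graph $G$ with $n$ vertices and at most $3n/2$ edges such that $A(G)<1.2908$.
   Context: A graph means a finite graph, possibly with multiple (parallel) edges. Each edge of a graph $G$ is regarded as a unit resistor, and $R_{xy}=R_{xy}(G)$ denotes the effective resistance between vertices $x,y$ in the resulting electrical network ($R_{xx}=0$, and $R_{xy}=\infty$ if $x,y$ lie in different components). For a graph $G$ with vertex set $V=\{1,\dots,n\}$, $n\ge 2$, the average resistance is $$A(G)=\frac{1}{\binom{n}{2}}\sum_{\substack{x,y\in V\\ x<y}}R_{xy}.$$ *)

(* Defs.v *)
From HB Require Import structures.
From mathcomp Require Import all_boot all_order all_algebra.
From mathcomp Require Import classical_sets reals constructive_ereal.
From mathcomp Require Import ring lra.

Set Implicit Arguments.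
Unset Strict Implicit.
Unset Printing Implicit Defensive.

Import Order.TTheory GRing.Theory Num.Theory.

Local Open Scope classical_set_scope.
Local Open Scope ring_scope.

(* A loopless multigraph is represented by its adjacency multiplicities;
   [mult] counts ordered pairs, so each edge {x, y} appears in both
   [mult x y] and [mult y x]. *)
Record multigraph (n : nat) := Multigraph {
  mult : 'I_n -> 'I_n -> nat;
  mult_sym : forall x y, mult x y = mult y x;
  mult_loopless : forall x, mult x x = 0%N
}.

Definition num_edges (n : nat) (G : multigraph n) : nat :=
  (\sum_(x : 'I_n) \sum_(y : 'I_n | (x < y)%N) mult G x y)%N.

Definition adj (n : nat) (G : multigraph n) : rel 'I_n :=
  fun x y => (0 < mult G x y)%N.

Section Resistance.
Variables (R : realType) (n : nat) (G : multigraph n).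
Implicit Types (v : 'I_n -> R) (x y z w : 'I_n).

(* Total current from z to w under the potential v (Ohm's law): each of the
   [mult G z w] parallel unit resistors carries v z - v w. *)
Definition current v z w : R := (mult G z w)%:R * (v z - v w).

(* Kirchhoff's current law when a unit current enters at x and leaves at y. *)
Definition unit_current_potential x y v : Prop :=
  forall z, \sum_(w : 'I_n) current v z w = (z == x)%:R - (z == y)%:R.

(* If x and y are connected, the set below is a singleton; see
   [unit_current_potential_exists] and [unit_current_potential_unique]. *)
Definition eff_res x y : \bar R :=
  if connect (adj G) x y then
    (xget 0 [set r : R | exists2 v, unit_current_potential x y v
                                  & r = v x - v y])%:E
  else +oo%E.

Definition avg_res : \bar R :=
  ((('C(n, 2))%:R^-1)%:E *
     \sum_(x : 'I_n) \sum_(y : 'I_n | (x < y)%N) eff_res x y)%E.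

Lemma harmonic_const v :
  (forall z, \sum_w current v z w = 0) ->
  forall x y, connect (adj G) x y -> v x = v y.
Proof.
move=> harm.
have en0 : \sum_z \sum_w (mult G z w)%:R * (v z - v w) ^+ 2 = 0.
  have e1 : \sum_z \sum_w v z * current v z w = 0.
    by rewrite big1 // => z _; rewrite -mulr_sumr harm mulr0.
  have e2 : \sum_z \sum_w - (v w * current v z w) = 0.
    rewrite exchange_big -[RHS]e1; apply: eq_bigr => z _; apply: eq_bigr => w _.
    by rewrite /current mult_sym -mulrN -mulrN opprB.
  transitivity (\sum_z \sum_w v z * current v z w +
                \sum_z \sum_w - (v w * current v z w)); last first.
    by rewrite e1 e2 addr0.
  rewrite -big_split; apply: eq_bigr => z _ /=.
  rewrite -big_split; apply: eq_bigr => w _ /=.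
  by rewrite /current; ring.
have edge z w : adj G z w -> v z = v w.
  move=> zw; have sq_ge0 a b : 0 <= (mult G a b)%:R * (v a - v b) ^+ 2.
    by rewrite mulr_ge0 ?sqr_ge0.
  have row_ge0 a : true -> 0 <= \sum_b (mult G a b)%:R * (v a - v b) ^+ 2.
    by move=> _; exact: sumr_ge0.
  have zrow := @psumr_eq0P R _ _ _ row_ge0 en0 z isT.
  have /eqP := @psumr_eq0P R _ _ _ (fun b _ => sq_ge0 z b) zrow w isT.
  rewrite mulf_eq0 pnatr_eq0 -leqn0 leqNgt [(0 < _)%N]zw sqrf_eq0 subr_eq0.
  by move/eqP.
move=> x y /connectP[p]; elim: p x => [|z p IHp] x /= => [_ ->|] //.
by case/andP=> /edge -> /IHp.
Qed.

Lemma unit_current_potential_unique x y v v' :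
  connect (adj G) x y ->
  unit_current_potential x y v -> unit_current_potential x y v' ->
  v x - v y = v' x - v' y.
Proof.
move=> xy vP v'P.
have := @harmonic_const (fun z => v z - v' z).
suff harm : forall z, \sum_w current (fun z => v z - v' z) z w = 0.
  by move=> /(_ harm _ _ xy) /=; lra.
move=> z; transitivity (\sum_w current v z w - \sum_w current v' z w).
  by rewrite -sumrB; apply: eq_bigr => w _; rewrite /current; ring.
by rewrite vP v'P subrr.
Qed.

Lemma unit_current_potential_exists x y :
  connect (adj G) x y -> exists v, unit_current_potential x y v.
Proof.
move=> xy.
pose deg z : R := \sum_w (mult G z w)%:R.
pose L : 'M[R]_n := \matrix_(z, w) ((z == w)%:R * deg z - (mult G z w)%:R).
have LE v z : \sum_w v w * L w z = \sum_w current v z w.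
  transitivity (\sum_w v w * ((w == z)%:R * deg w) -
                \sum_w v w * (mult G w z)%:R).
    by rewrite -sumrB; apply: eq_bigr => w _; rewrite mxE mulrBr.
  rewrite (bigD1 z) //= eqxx mul1r big1 ?addr0; last first.
    by move=> w /negPf ->; rewrite mul0r mulr0.
  rewrite /deg mulr_sumr -sumrB; apply: eq_bigr => w _.
  by rewrite /current [mult G w z]mult_sym -mulrBl mulrC.
pose u : 'rV[R]_n := \row_z ((z == x)%:R - (z == y)%:R).
have /submxP[D uE] : (u <= L)%MS.
  rewrite submxE; apply/eqP/rowP => j; rewrite !mxE.
  pose c z := cokermx L z j.
  have cxy : c x = c y.
    apply: harmonic_const xy => z; rewrite -LE.
    transitivity ((L *m cokermx L) z j); last by rewrite mulmx_coker mxE.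
    rewrite mxE; apply: eq_bigr => w _; rewrite mulrC /c !mxE.
    congr (_ * _); rewrite [mult G w z]mult_sym [w == z]eq_sym.
    by have [->|] := eqVneq z w; rewrite ?mul0r.
  transitivity (c x - c y); last by rewrite cxy subrr.
  under eq_bigr => z _ do rewrite mxE mulrBl.
  rewrite sumrB; congr (_ - _).
    by rewrite (bigD1 x) //= eqxx mul1r big1 ?addr0 // => z /negPf->; rewrite mul0r.
  by rewrite (bigD1 y) //= eqxx mul1r big1 ?addr0 // => z /negPf->; rewrite mul0r.
exists (D 0) => z; rewrite -LE.
by have := congr1 (fun M : 'rV_n => M 0 z) uE; rewrite !mxE => ->.
Qed.

Lemma eff_resE x y v :
  connect (adj G) x y -> unit_current_potential x y v ->
  eff_res x y = (v x - v y)%:E.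
Proof.
move=> xy vP; rewrite /eff_res xy; congr (_%:E).
apply: xget_unique => [|_ [v' v'P ->]]; first by exists v.
exact: unit_current_potential_unique v'P vP.
Qed.

Lemma eff_resxx x : eff_res x x = 0%:E.
Proof.
rewrite (@eff_resE x x (fun=> 0)) ?subrr // => z.
by rewrite big1 ?subrr // => w _; rewrite /current subrr mulr0.
Qed.

End Resistance.

(* Main.v *)
(* Consider the infinite tree in which every vertex of degree 4 has four
   neighbours of degree 3, and every vertex of degree 3 has two neighbours of
   degree 4 and one of degree 3.  The graphs are large girth quotients of this
   tree with a sparse set of vertices joined to a hub, and with enough pendant
   vertices at the hub to lower the average degree to 3.  The resistance between
   two vertices is at most the sum of their resistances to the hub, and the
   resistance to the hub is close to the resistance to infinity in the tree: a
   nearly optimal flow of the tree is followed up to a large depth r without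
   ever using an edge twice, by the girth assumption, and what remains is so
   spread out that a Poincare inequality, uniform in r, makes its energy
   negligible.  This yields an average resistance close to 1.29078.

   Large girth comes from letters acting as involutions on reduced words: in the
   group of permutations of the words of length at most r, distinct reduced
   words of length at most r give distinct permutations. *)
Require Import Defs.
From mathcomp Require Import all_boot all_order all_algebra all_fingroup.
From mathcomp Require Import reals constructive_ereal.
From mathcomp Require Import ring lra zify.

Set Implicit Arguments.
Unset Strict Implicit.
Unset Printing Implicit Defensive.

Import Order.TTheory GRing.Theory Num.Theory.
Local Open Scope ring_scope.

(** * Energy bounds on effective resistances *)

Lemma big_ltn_sym (V : nmodType) (n : nat) (F : 'I_n -> 'I_n -> V) :
  (forall x y, F x y = F y x) ->
  \sum_x \sum_y F x y =
    (\sum_(x < n) \sum_(y < n | (x < y)%N) F x y) *+ 2 + \sum_x F x x.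
Proof.
move=> Fsym.
have split3 x : \sum_y F x y =
    \sum_(y : 'I_n | (x < y)%N) F x y + \sum_(y : 'I_n | (y < x)%N) F x y + F x x.
  rewrite (bigID (fun y : 'I_n => (x < y)%N)) /= -addrA; congr (_ + _).
  rewrite (bigD1 x) ?ltnn //= addrC; congr (_ + _).
  by apply: eq_bigl => y; rewrite -leqNgt ltn_neqAle andbC.
rewrite (eq_bigr _ (fun x _ => split3 x)) !big_split /= mulr2n.
congr (_ + _ + _); rewrite (exchange_big_dep predT) //=.
by apply: eq_bigr => x _; apply: eq_bigr => y _.
Qed.

Section EffectiveResistanceBound.
Variables (R : realType) (n : nat) (G : multigraph n).
Implicit Types (v : 'I_n -> R) (x y z w : 'I_n).

(** Summation by parts against Kirchhoff's law; the factor 2 appears because the double sum meets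
    each edge in both directions. *)
Lemma unit_current_potential_power x y v :
  unit_current_potential G x y v ->
  \sum_z \sum_w (mult G z w)%:R * (v z - v w) ^+ 2 = 2 * (v x - v y).
Proof.
move=> vP.
have e1 : \sum_z \sum_w v z * current G v z w = v x - v y.
  under eq_bigr do rewrite -mulr_sumr vP mulrBr.
  rewrite sumrB; congr (_ - _).
    by rewrite (bigD1 x) //= eqxx mulr1 big1 ?addr0 // => z /negPf->; rewrite mulr0.
  by rewrite (bigD1 y) //= eqxx mulr1 big1 ?addr0 // => z /negPf->; rewrite mulr0.
rewrite mulr2n mulrDl mul1r -{1}e1 -e1 [X in _ = _ + X]exchange_big -big_split /=.
apply: eq_bigr => z _; rewrite -big_split; apply: eq_bigr => w _ /=.
by rewrite /current [mult G w z]mult_sym; ring.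
Qed.

(* Dual form of Thomson's principle: the energy of a potential is half of the
   double sum below. *)
Lemma eff_res_le x y (rho : R) :
  (forall v, 4 * (v x - v y) <=
     2 * rho + \sum_z \sum_w (mult G z w)%:R * (v z - v w) ^+ 2) ->
  (eff_res R G x y <= rho%:E)%E.
Proof.
move=> rhoP; case: (boolP (connect (adj G) x y)) => [xy|nxy]; last first.
  (* A large multiple of the indicator of the component of [x] has zero energy and violates the
     hypothesis. *)
  pose v z : R := (`|rho| + 1) * (connect (adj G) x z)%:R.
  have := rhoP v; rewrite big1 => [|z _]; last first.
    rewrite big1 // => w _; case: (posnP (mult G z w)) => [->|zw]; first by rewrite mul0r.
    have -> : v z = v w; last by rewrite subrr expr0n mulr0.
    have zw' : connect (adj G) z w by apply: connect1.
    have wz' : connect (adj G) w z by apply: connect1; rewrite /adj mult_sym.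
    rewrite /v; congr (_ * _%:R); congr nat_of_bool.
    by apply/idP/idP => /connect_trans; apply.
  rewrite /v connect0 (negPf nxy) mulr0 mulr1 => h.
  by exfalso; have := ler_norm rho; have := normr_ge0 rho; lra.
have [v vP] := @unit_current_potential_exists R _ _ _ _ xy.
rewrite (eff_resE xy vP) lee_fin.
by have := rhoP v; rewrite (unit_current_potential_power vP); lra.
Qed.

End EffectiveResistanceBound.

(* Splitting f - f h into positive and negative parts, whose energies add up to
   at most that of f, gives the triangle inequality for the resistances to h. *)
Lemma energy_bound_pair (R : realType) (V : finType) (m : V -> V -> nat) (h : V)
    (rho : V -> R) :
  (forall x (f : V -> R), f h = 0 ->
     4 * f x <= 2 * rho x + \sum_z \sum_w (m z w)%:R * (f z - f w) ^+ 2) ->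
  forall x y (f : V -> R),
     4 * (f x - f y) <=
       2 * (rho x + rho y) + \sum_z \sum_w (m z w)%:R * (f z - f w) ^+ 2.
Proof.
move=> rhoP x y f.
pose fp z := Num.max (f z - f h) 0; pose fn z := Num.max (f h - f z) 0.
have fp0 : fp h = 0 by rewrite /fp subrr maxxx.
have fn0 : fn h = 0 by rewrite /fn subrr maxxx.
have energy : \sum_z \sum_w (m z w)%:R * (fp z - fp w) ^+ 2 +
              \sum_z \sum_w (m z w)%:R * (fn z - fn w) ^+ 2 <=
              \sum_z \sum_w (m z w)%:R * (f z - f w) ^+ 2.
  rewrite -big_split ler_sum // => z _; rewrite -big_split ler_sum // => w _ /=.
  rewrite -mulrDr ler_wpM2l // /fp /fn.
  by case: (ltrP (f z - f h) 0); case: (ltrP (f w - f h) 0);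
    case: (ltrP (f h - f z) 0); case: (ltrP (f h - f w) 0) => *; nra.
have xP := rhoP x fp fp0; have yP := rhoP y fn fn0.
have : f x - f h <= fp x by rewrite le_max lexx.
have : f h - f y <= fn y by rewrite le_max lexx.
by lra.
Qed.

(** Each vertex lies in n - 1 pairs, so averaging [rho x + rho y] over all pairs gives twice the
    mean of [rho]. *)
Lemma network_avg_res (R : realType) (V : finType) (m : V -> V -> nat) (h : V)
    (rho : V -> R) (n : nat) :
  (1 < n)%N -> #|V| = n -> (forall x y, m x y = m y x) -> (forall x, m x x = 0%N) ->
  (forall x (f : V -> R), f h = 0 ->
     4 * f x <= 2 * rho x + \sum_z \sum_w (m z w)%:R * (f z - f w) ^+ 2) ->
  exists G : multigraph n,
    (2 * num_edges G = \sum_x \sum_y m x y)%N /\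
    (avg_res R G <= (2 * (\sum_x rho x) / n%:R)%:E)%E.
Proof.
move=> n_gt1 cardV msym mloop rhoP.
pose phi (i : 'I_n) : V := enum_val (cast_ord (esym cardV) i).
have phi_bij : bijective phi.
  exists (fun x => cast_ord cardV (enum_rank x)) => [i|x].
    by rewrite /phi enum_valK cast_ordKV.
  by rewrite /phi cast_ordK enum_rankK.
have sumE (W : nmodType) (F : V -> W) : \sum_x F x = \sum_(i < n) F (phi i).
  by rewrite (reindex phi) //; apply: onW_bij.
pose G := @Multigraph n (fun i j => m (phi i) (phi j))
  (fun i j => msym _ _) (fun i => mloop _).
exists G; split.
  have -> : (\sum_x \sum_y m x y = \sum_i \sum_j mult G i j)%N.
    by rewrite (sumE nat); apply: eq_bigr => i _; rewrite (sumE nat).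
  rewrite (big_ltn_sym (V := nat) (mult_sym G)) [X in _ = (_ + X)%R]big1; last first.
    by move=> i _; rewrite mult_loopless.
  by rewrite addr0 mul2n -addnn mulr2n.
have resP i j : (eff_res R G i j <= (rho (phi i) + rho (phi j))%:E)%E.
  apply: eff_res_le => v; have [psi phiK psiK] := phi_bij.
  have := @energy_bound_pair R V m h rho rhoP (phi i) (phi j) (v \o psi).
  rewrite /= !phiK => /le_trans; apply; rewrite lerD2l sumE.
  apply: ler_sum => z _; rewrite sumE; apply: ler_sum => w _.
  by rewrite /= !phiK.
have /le_trans : (avg_res R G <= ('C(n, 2))%:R^-1%:E *
    (\sum_(i < n) \sum_(j < n | (i < j)%N) (rho (phi i) + rho (phi j)))%:E)%E.
  rewrite /avg_res lee_pmul2l ?lte_fin ?invr_gt0 ?ltr0n ?bin_gt0 //.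
  rewrite -sumEFin; apply: lee_sum => i _; rewrite -sumEFin.
  by apply: lee_sum => j _.
apply; rewrite -EFinM lee_fin [in leRHS]sumE.
have := @big_ltn_sym R n (fun i j => rho (phi i) + rho (phi j)) (fun i j => addrC _ _).
under eq_bigr do rewrite big_split /= sumr_const card_ord.
rewrite !big_split /= sumrMnl sumr_const card_ord.
set P := \sum_(i < n) rho (phi i); set S := \sum_i _ => SE.
have {}SE : 2 * S = 2 * (n%:R - 1) * P.
  by move: SE; rewrite -[P *+ n]mulr_natl -[S *+ 2]mulr_natl; lra.
have binE : 2 * ('C(n, 2))%:R = n%:R * (n%:R - 1) :> R.
  rewrite -natrM -(mul_bin_diag n 1) bin1 natrM -subn1 natrB //.
  exact: ltnW.
have n0 : (1 : R) < n%:R by rewrite ltr1n.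
have b0 : 0 < ('C(n, 2))%:R :> R by rewrite ltr0n bin_gt0.
have -> : ('C(n, 2))%:R = n%:R * (n%:R - 1) / 2 :> R by rewrite -binE; field.
have -> : S = (n%:R - 1) * P by lra.
suff -> : (n%:R * (n%:R - 1) / 2)^-1 * ((n%:R - 1) * P) = 2 * P / n%:R by [].
by field; rewrite subr_eq0 !gt_eqF // (lt_trans ltr01).
Qed.

(** * Letters as involutions on reduced words *)

Section ReducedWords.
Variables (E : finType) (r : nat).

Definition reduced (w : seq E) := sorted (fun e e' => e != e') w.

Lemma reduced_behead e w : reduced (e :: w) -> reduced w.
Proof. exact: path_sorted. Qed.

(* Non-reduced words are fixed, which makes this an involution on all words of
   length at most r. *)
Definition toggle_seq (e : E) (w : seq E) : seq E :=
  if ~~ reduced w then w else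
  if ohead w == Some e then behead w else
  if (size w < r)%N then e :: w else w.

Lemma toggle_subproof e (w : r.-bseq E) : (size (toggle_seq e w) <= r)%N.
Proof.
have wr := size_bseq w; rewrite /toggle_seq; case: ifP => // _.
case: ifP => _; first by rewrite size_behead (leq_trans (leq_pred _)).
by case: ifP.
Qed.

Definition toggle e (w : r.-bseq E) : r.-bseq E := Bseq (toggle_subproof e w).

Lemma toggle_seqK e w : (size w <= r)%N -> toggle_seq e (toggle_seq e w) = w.
Proof.
move=> wr; rewrite {2}/toggle_seq.
case: (boolP (reduced w)) => [red|nred] /=; last by rewrite /toggle_seq nred.
case: (eqVneq (ohead w) (Some e)) => [|ne].
  case: w wr red => //= e' w wr red [ee']; rewrite ee' in red *.
  rewrite /toggle_seq (reduced_behead red) /= wr.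
  by case: w red {wr} => //= e'' w /andP[]; rewrite (inj_eq (@Some_inj _)) eq_sym => /negPf->.
case: ifP => wr'; last by rewrite /toggle_seq red (negPf ne) wr'.
have red' : reduced (e :: w).
  by case: w ne red {wr wr'} => //= e' w ne ->; rewrite andbT eq_sym; apply: contra ne => /eqP->.
by rewrite /toggle_seq red' /= eqxx.
Qed.

Lemma toggleK e : involutive (toggle e).
Proof. by move=> w; apply: val_inj; rewrite /= toggle_seqK ?size_bseq. Qed.

Definition letter_perm e : {perm r.-bseq E} := perm (can_inj (toggleK e)).

Lemma letter_permK e : (letter_perm e * letter_perm e)%g = 1%g.
Proof. by apply/permP => w; rewrite permM !permE /= toggleK. Qed.

(** Toggling the letters of [w] one by one builds [w] from the empty word, so the permutation
    reached from [g] determines [w]. This is the girth property. *)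
Lemma foldr_letter_perm (g : {perm r.-bseq E}) w :
  reduced w -> (size w <= r)%N ->
  foldr (fun e h => (h * letter_perm e)%g) g w ((g^-1)%g [bseq]) = w :> seq E.
Proof.
elim: w => [|e w IHw] red wr /=; first by rewrite permKV.
have {}IHw := IHw (reduced_behead red) (ltnW wr).
rewrite permM permE /= IHw /toggle_seq (reduced_behead red) /= wr.
by case: w red {IHw wr} => //= e' w /andP[]; rewrite (inj_eq (@Some_inj _)) eq_sym => /negPf->.
Qed.

End ReducedWords.

(** * Words as walks, and flows along them *)

Section Words.
Variable E : finType.

Fixpoint words k : seq (seq E) :=
  if k is k'.+1 then [seq e :: w | w <- words k', e <- enum E] else [:: [::]].

(** The pair (e, w) stands for the step from the end of [w] to the end of [e :: w]. *)
Definition steps r : seq (E * seq E) :=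
  flatten [seq [seq (e, w) | w <- words k, e <- enum E] | k <- iota 0 r].

Lemma mem_words k w : (w \in words k) = (size w == k).
Proof.
elim: k w => [|k IHk] [|e w] //=.
  by apply/allpairsP => -[] [w e] [].
rewrite eqSS -IHk; apply/allpairsP/idP => [[[w' e'] /= [? _ [_ ->]]] //|wk].
by exists (w, e); rewrite mem_enum.
Qed.

Lemma words_uniq k : uniq (words k).
Proof.
elim: k => //= k IHk; apply: allpairs_uniq; rewrite ?enum_uniq //.
by move=> [w e] [w' e'] _ _ [-> ->].
Qed.

Lemma mem_steps r p : (p \in steps r) = (size p.2 < r)%N.
Proof.
case: p => e w; apply/flatten_mapP/idP => /= [[k]|wr].
  rewrite mem_iota => kr /allpairsP[[w' e'] /= [w'k _ [_ ->]]].
  by rewrite mem_words in w'k; rewrite (eqP w'k).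
exists (size w); first by rewrite mem_iota.
by apply/allpairsP; exists (w, e); rewrite /= mem_words eqxx mem_enum.
Qed.

Lemma stepsS r :
  steps r.+1 = steps r ++ [seq (e, w) | w <- words r, e <- enum E].
Proof. by rewrite /steps -addn1 iotaD map_cat flatten_cat /= cats0 add0n. Qed.

Lemma steps_uniq r : uniq (steps r).
Proof.
elim: r => // r IHr; rewrite stepsS cat_uniq IHr /=; apply/andP; split.
  apply/hasPn => -[e w] /allpairsP[[w' e'] /= [w'k _ [_ ->]]].
  by rewrite mem_words in w'k; rewrite mem_steps /= (eqP w'k) ltnn.
apply: allpairs_uniq; rewrite ?enum_uniq ?words_uniq //.
by move=> [w e] [w' e'] _ _ [-> ->].
Qed.

End Words.

Section WordFlow.
Variables (R : realFieldType) (E X : finType) (nu : E -> X -> X).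
Hypothesis nuK : forall e, involutive (nu e).

Variables (x0 : X) (r : nat) (theta c : seq E -> R) (beta : R).

(* The last letter of the walk is the head of the word. *)
Definition walk (w : seq E) : X := foldr nu x0 w.

Hypothesis theta0 : theta [::] = 1.
Hypothesis theta_conserved : forall w, \sum_e theta (e :: w) = theta w.
Hypothesis theta_reduced : forall e w, theta (e :: w) != 0 -> ohead w != Some e.
Hypothesis theta_supp : forall e w, theta (e :: w) != 0 -> theta w != 0.
Hypothesis walk_inj : forall w w', (size w <= r)%N -> (size w' <= r)%N ->
  theta w != 0 -> theta w' != 0 -> walk w = walk w' -> w = w'.
Hypothesis c_ge0 : forall w, 0 <= c w.
Hypothesis theta_energy : forall w,
  \sum_e theta (e :: w) ^+ 2 * (1 + c (e :: w)) <= theta w ^+ 2 * c w.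
Hypothesis theta_decay : forall w, \sum_e theta (e :: w) ^+ 2 <= beta * theta w ^+ 2.
Hypothesis beta_ge0 : 0 <= beta.

(** [c w] bounds the energy a unit flow spends beyond [w]: the energy spent so far plus
    [theta w ^+ 2 * c w] summed over the frontier never increases with the depth. *)
Lemma word_flow_energy :
  \sum_(p <- steps E r) theta (p.1 :: p.2) ^+ 2 <= c [::].
Proof.
suff: \sum_(p <- steps E r) theta (p.1 :: p.2) ^+ 2 +
      \sum_(w <- words E r) theta w ^+ 2 * c w <= c [::].
  by apply: le_trans; rewrite lerDl sumr_ge0 // => w _; rewrite mulr_ge0 ?sqr_ge0.
elim: r => [|k IHk].
  by rewrite big_nil /= big_seq1 theta0 expr1n mul1r add0r.
apply: le_trans IHk; rewrite stepsS big_cat /= -addrA lerD2l.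
rewrite !big_allpairs_dep /= -big_split /=; apply: ler_sum => w _.
rewrite -big_split /= big_enum /=; apply: le_trans (theta_energy w).
by apply: ler_sum => e _; rewrite mulrDr mulr1.
Qed.

Lemma word_flow_decay : \sum_(w <- words E r) theta w ^+ 2 <= beta ^+ r.
Proof.
elim: r => [|k IHk]; first by rewrite /= big_seq1 theta0 expr1n.
rewrite /= big_allpairs_dep exprS; apply: le_trans (ler_wpM2l beta_ge0 IHk).
by rewrite mulr_sumr; apply: ler_sum => w _; rewrite big_enum.
Qed.

(** Conservation of the flow lets each frontier value be rewritten as a drop across the next edges
    plus values one level deeper. *)
Lemma word_flow_telescope (f : X -> R) :
  f x0 = \sum_(p <- steps E r) theta (p.1 :: p.2) *
                                 (f (walk p.2) - f (walk (p.1 :: p.2))) +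
         \sum_(w <- words E r) theta w * f (walk w).
Proof.
elim: r => [|k ->]; first by rewrite big_nil /= big_seq1 theta0 mul1r add0r.
rewrite stepsS big_cat /= -addrA; congr (_ + _).
rewrite !big_allpairs_dep /= -big_split /=; apply: eq_bigr => w _.
rewrite -big_split big_enum /= -{1}theta_conserved mulr_suml.
by apply: eq_bigr => e _; ring.
Qed.

Lemma sum_uniq_le (I : eqType) (T : finType) (s : seq I) (h : I -> T) (F : T -> R) :
  uniq (map h s) -> (forall t, 0 <= F t) -> \sum_(i <- s) F (h i) <= \sum_t F t.
Proof.
move=> us F0; rewrite -(big_map h predT) big_uniq //= [leRHS](bigID [in map h s]) /=.
by rewrite lerDl sumr_ge0.
Qed.

(* Distinct words end at distinct vertices, so each edge is used by at most one
   step and hence by at most one of the darts (x, e), (nu e x, e). *)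
Lemma word_flow_dirichlet (f : X -> R) :
  2 * \sum_(p <- steps E r | theta (p.1 :: p.2) != 0)
        (f (walk p.2) - f (walk (p.1 :: p.2))) ^+ 2 <=
  \sum_x \sum_e (f x - f (nu e x)) ^+ 2.
Proof.
pose F (d : X * E) := (f d.1 - f (nu d.2 d.1)) ^+ 2.
rewrite pair_big /= -[leRHS]/(\sum_d F d).
pose s := [seq p <- steps E r | theta (p.1 :: p.2) != 0].
rewrite -big_filter -/s.
have sP p : p \in s -> [/\ (size p.2 < r)%N, theta (p.1 :: p.2) != 0 & theta p.2 != 0].
  by rewrite mem_filter mem_steps => /andP[tp ->]; split=> //; exact: theta_supp tp.
have us : uniq s by rewrite filter_uniq // steps_uniq.
pose h1 (p : E * seq E) := (walk p.2, p.1).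
pose h2 (p : E * seq E) := (walk (p.1 :: p.2), p.1).
pose t := map inl s ++ map inr s : seq (E * seq E + E * seq E).
pose h p := match p with inl p => h1 p | inr p => h2 p end.
have -> : 2 * \sum_(p <- s) (f (walk p.2) - f (walk (p.1 :: p.2))) ^+ 2 =
    \sum_(p <- t) F (h p).
  rewrite big_cat !big_map /= mulr2n mulrDl mul1r; congr (_ + _).
  by apply: eq_bigr => p _; rewrite /F /= nuK -sqrrN opprB.
apply: sum_uniq_le => [|d]; last exact: sqr_ge0.
rewrite map_cat -!map_comp cat_uniq; apply/and3P; split.
- rewrite map_inj_in_uniq // => -[e w] [e' w'] /sP[/= wr _ tw] /sP[/= wr' _ tw'].
  by case=> /(walk_inj (ltnW wr) (ltnW wr') tw tw') -> ->.
- apply/hasPn => d /mapP[[e w] /sP[/= wr tew tw] ->].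
  apply/negP => /mapP[[e' w'] /sP[/= wr' tew' tw'] [ww' ee']]; subst e'.
  have w'E := @walk_inj (e :: w) w' wr (ltnW wr') tew tw' ww'.
  by have := theta_reduced tew'; rewrite -w'E eqxx.
- rewrite map_inj_in_uniq // => -[e w] [e' w'] /sP[/= wr tw _] /sP[/= wr' tw' _].
  by case=> /(@walk_inj (e :: w) (e' :: w') wr wr' tw tw')[-> ->].
Qed.

(** The arithmetic-geometric mean inequality is applied termwise to the telescoped sum, with weight
    [kappa] on the steps and [K] on the frontier. *)
Lemma word_flow_bound (f : X -> R) (kappa K : R) : 0 < kappa -> 0 < K ->
  4 * f x0 <= 2 * (kappa * c [::] + K * beta ^+ r) +
    kappa^-1 * \sum_x \sum_e (f x - f (nu e x)) ^+ 2 +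
    2 / K * \sum_x f x ^+ 2.
Proof.
have amgm (k a b : R) : 0 < k -> 4 * (a * b) <= 2 * k * a ^+ 2 + 2 / k * b ^+ 2.
  move=> k0; rewrite -subr_ge0.
  have -> : 2 * k * a ^+ 2 + 2 / k * b ^+ 2 - 4 * (a * b) = 2 / k * (k * a - b) ^+ 2.
    by field; rewrite gt_eqF.
  by rewrite mulr_ge0 ?sqr_ge0 ?divr_ge0 // ltW.
move=> kappa0 K0; rewrite word_flow_telescope mulrDr !mulr_sumr.
pose st p := f (walk p.2) - f (walk (p.1 :: p.2)).
have tr_le : \sum_(p <- steps E r) 4 * (theta (p.1 :: p.2) * st p) <=
    2 * kappa * c [::] + kappa^-1 * \sum_x \sum_e (f x - f (nu e x)) ^+ 2.
  apply: le_trans (lerD (ler_wpM2l _ word_flow_energy)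
    (ler_wpM2l _ (word_flow_dirichlet f))); last by rewrite invr_ge0 ltW.
    rewrite mulrA [kappa^-1 * 2]mulrC !mulr_sumr [X in _ + X]big_mkcond -big_split /=.
    apply: ler_sum => p _; case: eqP => [->|_] /=; last exact: amgm.
    by rewrite mul0r mulr0 expr0n mulr0 addr0.
  by rewrite mulr_ge0 ?ltW.
have end_le : \sum_(w <- words E r) 4 * (theta w * f (walk w)) <=
    2 * K * beta ^+ r + 2 / K * \sum_x f x ^+ 2.
  have uw : uniq [seq walk w | w <- words E r & theta w != 0].
    rewrite map_inj_in_uniq ?filter_uniq ?words_uniq // => w w'.
    rewrite !mem_filter !mem_words => /andP[tw /eqP wr] /andP[tw' /eqP wr'].
    by apply: walk_inj; rewrite ?wr ?wr'.
  apply: le_trans (lerD (ler_wpM2l _ word_flow_decay)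
    (ler_wpM2l _ (sum_uniq_le uw (fun x => sqr_ge0 (f x))))).
  - rewrite big_filter !mulr_sumr [X in _ + X]big_mkcond -big_split /=.
    apply: ler_sum => w _; case: eqP => [->|_] /=; last exact: amgm.
    by rewrite mul0r mulr0 expr0n mulr0 addr0.
  - by rewrite mulr_ge0 ?ltW.
  - by rewrite divr_ge0 // ltW.
apply: le_trans (lerD tr_le end_le) _.
by rewrite -!mulr_sumr mulrDr !mulrA addrACA !addrA.
Qed.

End WordFlow.

(** * The labelled tree and its nearly optimal flow *)

Lemma big_option (A : Type) (idx : A) (op : Monoid.com_law idx) (T : finType)
    (F : option T -> A) :
  \big[op/idx]_(o : option T) F o = op (F None) (\big[op/idx]_(t : T) F (Some t)).
Proof.
rewrite -big_enum -[X in op _ X]big_enum /=.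
have -> : enum {: option T} = None :: map Some (enum T) by rewrite !enumT [in LHS]unlock.
by rewrite big_cons big_map.
Qed.

(* Labels of the vertices of the tree: None has degree 4, Some s has degree 3.
   The letter Some (s, b), b a boolean, is one of the two edges at Some s leading
   to None, and the letter None is the edge between the two labels Some s. *)
Definition label := option bool.
Definition letter := option (bool * bool).

(** A letter that names no edge at [v] fixes [v], so every letter acts as an involution. *)
Definition label_step (e : letter) (v : label) : label :=
  match e, v with
  | None, Some s => Some (~~ s)
  | None, None => None
  | Some (s, _), None => Some s
  | Some (s, _), Some s' => if s == s' then None else Some s'
  end.

Lemma label_stepK e : involutive (label_step e).
Proof. by case: e => [[[] []]|] [[]|]. Qed.

Lemma big_letter (A : Type) (idx : A) (op : Monoid.com_law idx) (F : letter -> A) :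
  \big[op/idx]_(e : letter) F e =
  op (F None) (op (op (F (Some (true, true))) (F (Some (true, false))))
                  (op (F (Some (false, true))) (F (Some (false, false))))).
Proof.
rewrite big_option; congr (op _ _).
transitivity (\big[op/idx]_(a : bool) \big[op/idx]_(b : bool) F (Some (a, b))).
  by rewrite pair_bigA; apply: eq_bigr => -[].
by rewrite big_bool !big_bool.
Qed.

Section Splitting.
Variable R : realFieldType.

(* A letter oe that cannot lead to v is treated like None, the start of a walk,
   so that the identities below hold for all v and oe. *)
Definition last_letter (v : label) (oe : option letter) : option letter :=
  if oe is Some e then if label_step e v == v then None else Some e else None.

(* Proportion of the flow that entered v through oe and leaves it through e: 19/36
   and 19/55 are convergents of the optimal ratios, which lie in Q(sqrt 5). *)
Definition split_ratio (v : label) (oe : option letter) (e : letter) : R :=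
  if (label_step e v == v) || (oe == Some e) then 0 else
  match v, last_letter v oe with
  | None, None => 1 / 4
  | None, Some _ => 1 / 3
  | Some _, None => if e is Some _ then 19 / 55 else 17 / 55
  | Some _, Some None => 1 / 2
  | Some _, Some (Some _) => if e is Some _ then 19 / 36 else 17 / 36
  end.

(* Energy beyond v of a unit flow that entered v through oe; cx, cy and cz solve
   the linear system cz = (1 + cx) / 3, cy = (1 + cz) / 2 and
   cx = (19/36)^2 (1 + cz) + (17/36)^2 (1 + cy). *)
Definition tree_energy (v : label) (oe : option letter) : R :=
  let cx := 18 * 107 / (41 * 55) in let cz := (1 + cx) / 3 in let cy := (1 + cz) / 2 in
  match v, last_letter v oe with
  | None, None => (1 + cx) / 4
  | None, Some _ => cz
  | Some _, None => 2 * (19 / 55) ^+ 2 * (1 + cz) + (17 / 55) ^+ 2 * (1 + cy)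
  | Some _, Some None => cy
  | Some _, Some (Some _) => cx
  end.

Lemma split_ratio_sum v oe : \sum_e split_ratio v oe e = 1.
Proof.
by rewrite big_letter; case: v => [[]|]; case: oe => [[[[] []]|]|];
  rewrite /split_ratio /last_letter /=; lra.
Qed.

(** The largest value is 325/648, from 19/36 and 17/36; a bound below 1 makes the flow spread out
    geometrically. *)
Lemma split_ratio_sqr_sum v oe : \sum_e split_ratio v oe e ^+ 2 <= 3 / 5.
Proof.
by rewrite big_letter; case: v => [[]|]; case: oe => [[[[] []]|]|];
  rewrite /split_ratio /last_letter /=; lra.
Qed.

Lemma tree_energy_ge0 v oe : 0 <= tree_energy v oe.
Proof. by rewrite /tree_energy; case: v => [?|]; case: last_letter => [[?|]|]; lra. Qed.

(** In fact an equality, by the linear system for cx, cy and cz. *)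
Lemma tree_energy_split v oe :
  \sum_e split_ratio v oe e ^+ 2 * (1 + tree_energy (label_step e v) (Some e))
    <= tree_energy v oe.
Proof.
by rewrite big_letter; case: v => [[]|]; case: oe => [[[[] []]|]|];
  rewrite /split_ratio /tree_energy /last_letter /=; lra.
Qed.

End Splitting.

(** * The finite cover and its Poincare inequality *)

Section Cover.
Variables M r m : nat.

(* A vertex consists of a label, a layer, a permutation and the index of a copy.
   The layers form a path on which the letters Some (s, false) and
   Some (s, true) act as the two reflections exchanging neighbours; they bound
   the distance to layer 0, which is joined to the hub, independently of r. *)
Definition covering : finType :=
  (label * ('I_M.+1 * {perm r.-bseq letter} * 'I_m))%type.

Definition cover_layer (x : covering) : 'I_M.+1 := x.2.1.1.

(** The edge from layer y to y + 1 is coloured by the parity of y. Where the path ends the layer is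
    fixed; at 0 this uses that the predecessor of 0 is 0. *)
Definition layer_step (e : letter) (y : 'I_M.+1) : 'I_M.+1 :=
  if e is Some (_, b) then
    if odd y == b then (if (y < M)%N then inord y.+1 else y) else inord y.-1
  else y.

Lemma layer_stepK e : involutive (layer_step e).
Proof.
case: e => [[s b]|] //= y; have yM := ltn_ord y.
rewrite {2}/layer_step; case: (eqVneq (odd y) b) => [yb|nyb]; rewrite /layer_step.
  case: ltnP => yM'; last by rewrite yb eqxx ltnNge yM'.
  rewrite inordK ?ltnS //= yb; have -> : (~~ b == b) = false by case: (b).
  by apply: val_inj; rewrite /= inordK.
case: (posnP y) => [y0|y_gt0].
  have -> : inord y.-1 = y by apply: val_inj; rewrite /= inordK y0.
  by rewrite (negPf nyb); apply: val_inj; rewrite /= inordK y0.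
have yM1 : (y.-1 < M.+1)%N by rewrite (leq_ltn_trans (leq_pred y)).
rewrite inordK //.
have -> : (odd y.-1 == b) = true.
  by move: nyb; rewrite -{1}(prednK y_gt0) /=; case: (odd _); case: (b).
have -> : (y.-1 < M)%N by rewrite prednK.
by apply: val_inj; rewrite /= prednK // inordK.
Qed.

Definition cover_step (e : letter) (x : covering) : covering :=
  if label_step e x.1 == x.1 then x else
  (label_step e x.1,
   (layer_step e x.2.1.1, (x.2.1.2 * letter_perm r e)%g, x.2.2)).

Lemma cover_step_label e x : (cover_step e x).1 = label_step e x.1.
Proof. by rewrite /cover_step; case: eqP. Qed.

Lemma cover_stepK e : involutive (cover_step e).
Proof.
move=> [v [[y g] i]]; rewrite /cover_step /=; case: (eqVneq (label_step e v) v) => h /=.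
  by rewrite h eqxx.
by rewrite label_stepK eq_sym (negPf h) layer_stepK -mulgA letter_permK mulg1.
Qed.

Lemma cover_step_neq e x : (cover_step e x == x) = (label_step e x.1 == x.1).
Proof.
apply/eqP/eqP => [{2}<-|h]; first by rewrite cover_step_label.
by rewrite /cover_step h eqxx.
Qed.

Definition cover_mult (x x' : covering) : nat :=
  \sum_(e : letter) ((x != x') && (cover_step e x == x')).

Lemma cover_mult_sym x x' : cover_mult x x' = cover_mult x' x.
Proof.
apply: eq_bigr => e _; rewrite eq_sym; congr (nat_of_bool (_ && _)).
by apply/eqP/eqP => <-; rewrite cover_stepK.
Qed.

Lemma cover_mult_loop x : cover_mult x x = 0%N.
Proof. by rewrite /cover_mult big1 // => e _; rewrite eqxx. Qed.

Lemma sum_cover_mult (R : pzSemiRingType) (x : covering) (F : covering -> R) :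
  \sum_x' (cover_mult x x')%:R * F x' =
  \sum_e (cover_step e x != x)%:R * F (cover_step e x).
Proof.
under eq_bigr do rewrite natr_sum mulr_suml.
rewrite exchange_big /=; apply: eq_bigr => e _.
rewrite (bigD1 (cover_step e x)) //= big1 ?addr0 => [|x' nx'].
  by rewrite eqxx andbT eq_sym.
by rewrite [cover_step e x == x']eq_sym (negPf nx') andbF mul0r.
Qed.

Lemma sum_label (W : nmodType) (F : label -> W) :
  \sum_(x : covering) F x.1 =
  (\sum_v F v) *+ (M.+1 * #|{perm r.-bseq letter}| * m).
Proof.
rewrite -(pair_bigA _ (fun v _ => F v)) /= -sumrMnl.
by apply: eq_bigr => v _; rewrite sumr_const !card_prod !card_ord.
Qed.

(** The three labels have degrees 4, 3 and 3, with sum 10. *)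
Lemma cover_mult_total :
  (\sum_(x : covering) \sum_x' cover_mult x x' =
   10 * (M.+1 * #|{perm r.-bseq letter}| * m))%N.
Proof.
transitivity ((\sum_(x : covering) \sum_e (label_step e x.1 != x.1)%:R)%R : nat).
  apply: eq_bigr => x _.
  transitivity ((\sum_x' (cover_mult x x')%:R * 1)%R : nat).
    by apply: eq_bigr => x' _; rewrite mulr1 natn.
  rewrite (@sum_cover_mult nat x (fun=> 1)).
  by apply: eq_bigr => e _; rewrite mulr1 cover_step_neq.
rewrite (@sum_label nat (fun v => \sum_e (label_step e v != v)%:R)).
rewrite -mulr_natr natn; congr (_ * _)%N.
by rewrite big_option big_bool !big_letter.
Qed.

Section Energy.
Variable R : realType.
Implicit Types f : covering -> R.

Definition cover_dirichlet f := \sum_x \sum_e (f x - f (cover_step e x)) ^+ 2.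
Definition layer0_sum f := \sum_(x | cover_layer x == ord0) f x ^+ 2.

Lemma cover_dirichlet_ge0 f : 0 <= cover_dirichlet f.
Proof. by apply: sumr_ge0 => x _; apply: sumr_ge0 => e _; exact: sqr_ge0. Qed.

Lemma layer0_sum_ge0 f : 0 <= layer0_sum f.
Proof. by apply: sumr_ge0 => x _; exact: sqr_ge0. Qed.

Lemma cover_mult_dirichlet f :
  \sum_x \sum_x' (cover_mult x x')%:R * (f x - f x') ^+ 2 = cover_dirichlet f.
Proof.
apply: eq_bigr => x _; rewrite (sum_cover_mult x (fun x' => (f x - f x') ^+ 2)).
apply: eq_bigr => e _; case: eqVneq => [->|_]; last by rewrite mul1r.
by rewrite subrr expr0n mulr0.
Qed.

(* Each vertex outside layer 0 has a neighbour in the layer below. *)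
Lemma layer_sum_le f (j : 'I_M.+1) :
  \sum_(x | cover_layer x == j) f x ^+ 2 <=
    12 ^+ j * (cover_dirichlet f + 2 * layer0_sum f).
Proof.
have D0 := cover_dirichlet_ge0 f.
have H0 := layer0_sum_ge0 f.
case: j => j; elim: j => [|j IHj] jM.
  rewrite expr0 mul1r (_ : Ordinal jM = ord0); last exact: val_inj.
  by rewrite -/(layer0_sum f); lra.
have {}IHj := IHj (ltnW jM).
set jo := Ordinal (ltnW jM) in IHj.
(* The opposite parity selects the reflection going down. At label [None] either value of s would
   do; [false] is taken. *)
pose down (v : label) : letter := Some (odflt false v, ~~ odd j.+1).
have downP x : cover_layer x == Ordinal jM -> cover_layer (cover_step (down x.1) x) == jo.
  case: x => v [[y g] i] /eqP yj; rewrite /cover_layer /= in yj *.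
  rewrite /cover_step (_ : label_step _ _ == _ = false); last by case: v => [[]|].
  by rewrite /= yj /=; case: (odd j); rewrite //= -val_eqE /= inordK // ltnW.
have step_le x : cover_layer x == Ordinal jM ->
    f x ^+ 2 <= 2 * \sum_(e | cover_layer (cover_step e x) == jo) f (cover_step e x) ^+ 2 +
                2 * \sum_e (f x - f (cover_step e x)) ^+ 2.
  move=> /downP xj; set e := down x.1 in xj.
  have -> : f x ^+ 2 = (f (cover_step e x) + (f x - f (cover_step e x))) ^+ 2.
    by rewrite addrC subrK.
  apply: (@le_trans _ _ (2 * f (cover_step e x) ^+ 2 + 2 * (f x - f (cover_step e x)) ^+ 2)).
    by set a := f _; set b := _ - _; have := sqr_ge0 (a - b); nra.
  apply: lerD; rewrite ler_wpM2l // (bigD1 e) //= lerDl sumr_ge0 // => ? _; exact: sqr_ge0.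
apply: le_trans (ler_sum _ step_le) _; rewrite big_split /= -!mulr_sumr.
(* Each of the five letters permutes the vertices, so a vertex below is counted at most five
   times. *)
have first_le : \sum_(x | cover_layer x == Ordinal jM)
    \sum_(e | cover_layer (cover_step e x) == jo) f (cover_step e x) ^+ 2 <=
    5 * \sum_(x | cover_layer x == jo) f x ^+ 2.
  apply: (@le_trans _ _ (\sum_x \sum_(e | cover_layer (cover_step e x) == jo)
                           f (cover_step e x) ^+ 2)).
    rewrite [leRHS](bigID [pred x | cover_layer x == Ordinal jM]) /= lerDl.
    by do 2!apply: sumr_ge0 => ? _; exact: sqr_ge0.
  rewrite (exchange_big_dep predT) //=.
  have -> : 5 * \sum_(x | cover_layer x == jo) f x ^+ 2 =
      \sum_(e : letter) \sum_(x | cover_layer x == jo) f x ^+ 2.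
    by rewrite big_letter /=; ring.
  rewrite le_eqVlt; apply/orP; left; apply/eqP; apply: eq_bigr => e _.
  rewrite [RHS](reindex_inj (inv_inj (cover_stepK e))) /=.
  by apply: eq_bigl => x.
have second_le : \sum_(x | cover_layer x == Ordinal jM)
    \sum_e (f x - f (cover_step e x)) ^+ 2 <= cover_dirichlet f.
  rewrite /cover_dirichlet [leRHS](bigID [pred x | cover_layer x == Ordinal jM]) /= lerDl.
  by do 2!apply: sumr_ge0 => ? _; exact: sqr_ge0.
(* The base 12 comes from 10 * 12^j + 2 <= 12^(j+1). *)
have pow_ge1 : 1 <= 12 ^+ j :> R by rewrite exprn_ege1 // ler1n.
rewrite exprS /=; move: IHj first_le second_le pow_ge1 => /=.
set p := 12 ^+ j; set D := cover_dirichlet f in D0 *; set H := layer0_sum f in H0 *.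
by move=> *; nra.
Qed.

(** The constant depends on [M] alone, which allows [r] to be chosen after it. *)
Lemma cover_sum_sqr_le f :
  \sum_x f x ^+ 2 <= M.+1%:R * 12 ^+ M * (cover_dirichlet f + 2 * layer0_sum f).
Proof.
rewrite (partition_big cover_layer predT) //=.
have D0 := cover_dirichlet_ge0 f.
have H0 := layer0_sum_ge0 f.
have -> : M.+1%:R * 12 ^+ M * (cover_dirichlet f + 2 * layer0_sum f) =
    \sum_(j < M.+1) 12 ^+ M * (cover_dirichlet f + 2 * layer0_sum f).
  by rewrite sumr_const card_ord -mulrA mulr_natl.
apply: ler_sum => j _; apply: le_trans (layer_sum_le f j) _.
rewrite ler_wpM2r ?addr_ge0 ?mulr_ge0 // ler_weXn2l ?ler1n //.
by rewrite -ltnS.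
Qed.

Fixpoint tree_flow (v0 : label) (w : seq letter) : R :=
  if w is e :: w' then
    tree_flow v0 w' * split_ratio R (foldr label_step v0 w') (ohead w') e
  else 1.

(** The flow never backtracks, and the permutation coordinate of its walk records the word. The
    layer is irrelevant for injectivity and left unspecified. *)
Lemma tree_flowP v0 y g i w :
  tree_flow v0 w != 0 ->
  reduced w /\
  exists y', walk cover_step (v0, (y, g, i)) w =
    (foldr label_step v0 w,
     (y', foldr (fun e h => (h * letter_perm r e)%g) g w, i)).
Proof.
elim: w => [|e w IHw] /=; first by move=> _; split=> //; exists y.
rewrite mulf_eq0 negb_or => /andP[/IHw[red [y' wE]]] h; split.
  case: w red h {IHw wE} => //= e' w -> h; rewrite andbT.
  by apply: contraNneq h => ->; rewrite /split_ratio eqxx orbT.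
exists (layer_step e y'); rewrite /= wE /cover_step /= ifN //.
by apply: contra h => h1; rewrite /split_ratio h1.
Qed.

Lemma cover_bound f (x : covering) (kappa K : R) :
  0 < kappa -> 0 < K ->
  kappa^-1 + 2 / K * (M.+1%:R * 12 ^+ M) <= 1 ->
  4 * f x <= 2 * (kappa * tree_energy R x.1 None + K * (3 / 5) ^+ r) +
             (cover_dirichlet f + 2 * layer0_sum f).
Proof.
case: x => v0 [[y g] i] kappa0 K0 kK /=; set x0 := (v0, _).
pose c w := tree_energy R (foldr label_step v0 w) (ohead w).
have := @word_flow_bound R letter covering cover_step cover_stepK x0 r
  (tree_flow v0) c (3 / 5) _ _ _ _ _ _ _ _ _ f kappa K kappa0 K0.
rewrite -/(cover_dirichlet f) => /= bound; apply: le_trans (bound _ _ _ _ _ _ _ _ _) _ => //.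
- by move=> w; rewrite -mulr_sumr split_ratio_sum mulr1.
- move=> e w; rewrite mulf_eq0 negb_or => /andP[_].
  by apply: contra => /eqP h; rewrite /split_ratio h eqxx orbT.
- by move=> e w; rewrite mulf_eq0 negb_or => /andP[].
- move=> w w' wr wr' /(tree_flowP y g i)[red [y1 ->]] /(tree_flowP y g i)[red' [y2 ->]].
  by case=> _ _ gE; rewrite -(foldr_letter_perm g red wr) gE foldr_letter_perm.
- by move=> w; exact: tree_energy_ge0.
- move=> w; under eq_bigr do rewrite exprMn -mulrA.
  by rewrite -mulr_sumr ler_wpM2l ?sqr_ge0 //; exact: tree_energy_split.
- move=> w; under eq_bigr do rewrite exprMn.
  by rewrite -mulr_sumr mulrC ler_wpM2r ?sqr_ge0 //; exact: split_ratio_sqr_sum.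
- by rewrite divr_ge0.
- have H0 := layer0_sum_ge0 f.
  have D0 := cover_dirichlet_ge0 f.
  have sqr_le := ler_wpM2l (ltW (divr_gt0 (ltr0n R 2) K0)) (cover_sum_sqr_le f).
  have DH0 : 0 <= cover_dirichlet f + 2 * layer0_sum f by lra.
  have := ler_wpM2r DH0 kK; rewrite mul1r mulrDl.
  have : kappa^-1 * cover_dirichlet f <= kappa^-1 * (cover_dirichlet f + 2 * layer0_sum f).
    by rewrite ler_wpM2l ?invr_ge0 ?(ltW kappa0) //; lra.
  rewrite mulrA in sqr_le; move: sqr_le; rewrite -!addrA lerD2l.
  by move=> h1 h2 h3; apply: le_trans (lerD h2 h1) h3.
Qed.

End Energy.
End Cover.

(** * The cover joined to the hub *)

Section HubNetwork.
Variables M r m l : nat.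

Local Notation copies := (#|{perm r.-bseq letter}| * m)%N.

(* The hub is None and the l pendant vertices are the Some (inr i). *)
Definition hub_network : finType := option (covering M r m + 'I_l).

Definition hub_mult (z w : hub_network) : nat :=
  match z, w with
  | Some (inl x), Some (inl x') => cover_mult x x'
  | None, Some (inl x) | Some (inl x), None => cover_layer x == ord0
  | None, Some (inr _) | Some (inr _), None => 1
  | _, _ => 0
  end.

Lemma hub_mult_sym z w : hub_mult z w = hub_mult w z.
Proof. by case: z w => [[x|i]|] [[x'|j]|] //=; exact: cover_mult_sym. Qed.

Lemma hub_mult_loop z : hub_mult z z = 0%N.
Proof. by case: z => [[x|i]|] //=; exact: cover_mult_loop. Qed.

Lemma card_hub_network : #|{: hub_network}| = (3 * (M.+1 * copies) + l).+1.
Proof.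
rewrite card_option card_sum card_ord !card_prod !card_ord.
by rewrite card_option card_bool -[(_ * #|_| * m)%N]mulnA.
Qed.

Lemma card_layer0 : (\sum_(x : covering M r m) (cover_layer x == ord0) = 3 * copies)%N.
Proof.
rewrite -(pair_bigA _ (fun _ q => nat_of_bool (q.1.1 == ord0))) /=.
rewrite sum_nat_const card_option card_bool; congr (_ * _)%N.
rewrite -(pair_bigA _ (fun yg _ => nat_of_bool (yg.1 == ord0))) /=.
under eq_bigr do rewrite sum_nat_const card_ord mulnC.
rewrite -big_distrl /=; congr (_ * _)%N.
rewrite -(pair_bigA _ (fun y _ => nat_of_bool (y == ord0))) /=.
under eq_bigr do rewrite sum_nat_const mulnC.
by rewrite -big_distrl /= (bigD1 ord0) //= big1 ?mul1n // => y /negPf->.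
Qed.

Lemma hub_mult_total :
  (\sum_z \sum_w hub_mult z w = 10 * (M.+1 * copies) + 6 * copies + 2 * l)%N.
Proof.
rewrite big_option /= big_option big_sumType /= add0n card_layer0.
rewrite sum_nat_const card_ord muln1 big_sumType /=.
have -> : (\sum_(x : covering M r m) \sum_w hub_mult (Some (inl x)) w =
    3 * copies + 10 * (M.+1 * copies))%N.
  rewrite -card_layer0 [(M.+1 * _)%N]mulnA -cover_mult_total -big_split /=; apply: eq_bigr => x _.
  by rewrite big_option big_sumType /= [X in (_ + (_ + X))%N]big1 // addn0.
have -> : (\sum_(i < l) \sum_w hub_mult (Some (inr i)) w = l)%N.
  rewrite -[RHS](card_ord l) -[RHS]muln1 -sum_nat_const; apply: eq_bigr => i _.
  by rewrite big_option big_sumType /= !big1.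
lia.
Qed.

Section Energy.
Variable R : realType.

Lemma hub_energy (f : hub_network -> R) : f None = 0 ->
  \sum_z \sum_w (hub_mult z w)%:R * (f z - f w) ^+ 2 =
  cover_dirichlet (fun x => f (Some (inl x))) +
  2 * layer0_sum (fun x => f (Some (inl x))) + 2 * \sum_(i < l) f (Some (inr i)) ^+ 2.
Proof.
move=> f0; rewrite big_option /= big_option big_sumType /= mul0r add0r big_sumType /= f0.
have layerE : layer0_sum (fun x => f (Some (inl x))) =
    \sum_(x : covering M r m) (cover_layer x == ord0)%:R * f (Some (inl x)) ^+ 2.
  by rewrite /layer0_sum big_mkcond; apply: eq_bigr => x _; case: ifP; rewrite ?mul1r ?mul0r.
have -> : \sum_(x : covering M r m) \sum_w
      (hub_mult (Some (inl x)) w)%:R * (f (Some (inl x)) - f w) ^+ 2 =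
    layer0_sum (fun x => f (Some (inl x))) + cover_dirichlet (fun x => f (Some (inl x))).
  rewrite layerE -cover_mult_dirichlet -big_split /=; apply: eq_bigr => x _.
  rewrite big_option big_sumType /= [X in _ + (_ + X)]big1 => [|i _]; last by rewrite mul0r.
  by rewrite addr0 f0 subr0.
have -> : \sum_(i < l) \sum_w
      (hub_mult (Some (inr i)) w)%:R * (f (Some (inr i)) - f w) ^+ 2 =
    \sum_(i < l) f (Some (inr i)) ^+ 2.
  apply: eq_bigr => i _; rewrite big_option big_sumType /= f0 subr0 mul1r.
  by rewrite !big1 ?addr0 // => ? _; rewrite mul0r.
rewrite layerE; under eq_bigr do rewrite sub0r sqrrN.
under [X in _ + X + _ = _]eq_bigr do rewrite mul1r sub0r sqrrN.
by ring.
Qed.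

Lemma hub_avg_res (n : nat) (kappa K : R) :
  0 < kappa -> 0 < K -> kappa^-1 + 2 / K * (M.+1%:R * 12 ^+ M) <= 1 ->
  (1 < n)%N -> n = (3 * (M.+1 * copies) + l).+1 ->
  exists G : multigraph n,
    (2 * num_edges G = 10 * (M.+1 * copies) + 6 * copies + 2 * l)%N /\
    (avg_res R G <= (2 * ((M.+1 * copies)%:R *
        (kappa * (\sum_v tree_energy R v None) + 3 * (K * (3 / 5) ^+ r)) + l%:R)
        / n%:R)%:E)%E.
Proof.
move=> kappa0 K0 kK n1 nE.
pose rho (z : hub_network) : R := match z with
  | None => 0
  | Some (inl x) => kappa * tree_energy R x.1 None + K * (3 / 5) ^+ r
  | Some (inr _) => 1
  end.
have [|||z f f0|G [GE Gavg]] := @network_avg_res R hub_network hub_mult None rho n n1.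
- by rewrite card_hub_network nE.
- exact: hub_mult_sym.
- exact: hub_mult_loop.
- rewrite hub_energy //.
  have D0 := cover_dirichlet_ge0 (fun x => f (Some (inl x))).
  have H0 := layer0_sum_ge0 (fun x => f (Some (inl x))).
  have L0 : 0 <= \sum_(i < l) f (Some (inr i)) ^+ 2.
    by apply: sumr_ge0 => x _; exact: sqr_ge0.
  case: z => [[x|i]|] /=; last by rewrite f0; lra.
    have := cover_bound (fun x => f (Some (inl x))) x kappa0 K0 kK; lra.
  have : f (Some (inr i)) ^+ 2 <= \sum_(i < l) f (Some (inr i)) ^+ 2.
    by rewrite (bigD1 i) //= lerDl sumr_ge0 // => j _; exact: sqr_ge0.
  (* A pendant vertex has resistance 1 to the hub: 4t <= 2 + 2t^2. *)
  by have := sqr_ge0 (f (Some (inr i)) - 1); nra.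
exists G; split; first by rewrite GE hub_mult_total.
suff -> : (M.+1 * copies)%:R * (kappa * (\sum_v tree_energy R v None) +
    3 * (K * (3 / 5) ^+ r)) + l%:R = \sum_z rho z by [].
rewrite [RHS]big_option big_sumType /= add0r sumr_const card_ord; congr (_ + _).
rewrite (@sum_label M r m R (fun v => kappa * tree_energy R v None + K * (3 / 5) ^+ r)).
rewrite -[(_ * #|_| * m)%N]mulnA -[RHS]mulr_natl; congr (_ * _).
by rewrite big_split /= -mulr_sumr sumr_const card_option card_bool mulr_natl.
Qed.

End Energy.
End HubNetwork.

(** * Numerical estimates and the choice of parameters *)

Lemma sum_tree_energy (R : realFieldType) :
  \sum_v tree_energy R v None <= 1 + 581 / 10 ^+ 3 + 56 / 10 ^+ 5.
Proof. by rewrite big_option big_bool /tree_energy /=; lra. Qed.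

Lemma geometric_small (R : archiRealFieldType) (K eps : R) :
  0 < K -> 0 < eps -> exists r, K * (3 / 5) ^+ r <= eps.
Proof.
move=> K0 eps0.
(* The induction rests on 3(k + 3) <= 5(k + 2). *)
have geo k : (3 / 5) ^+ k * (k%:R + 2) <= 2 :> R.
  elim: k => [|k IHk]; first by rewrite expr0 mul1r add0r.
  have := exprn_ge0 k (divr_ge0 (ler0n R 3) (ler0n R 5)).
  have := ler0n R k; move: IHk; rewrite exprS -natr1.
  by set p := _ ^+ k; set x := k%:R => *; nra.
have := archi_boundP (ltW (divr_gt0 (mulr_gt0 (ltr0n R 2) K0) eps0)).
set k := Num.bound _; rewrite ltr_pdivrMr // => kP; exists k.
have := geo k; have := exprn_ge0 k (divr_ge0 (ler0n R 3) (ler0n R 5)).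
have := ler0n R k; move: kP; set p := _ ^+ k; set x := k%:R => kP x0 p0 px.
rewrite -(ler_pM2r (_ : 0 < x + 2)); last lra.
by nra.
Qed.

Theorem theorem1 (R : realType) :
  exists N : nat, forall n : nat, (N <= n)%N ->
    exists G : multigraph n,
      (2 * num_edges G <= 3 * n)%N /\
      (avg_res R G < (1 + 2908 / 10 ^+ 4)%:E)%E.
Proof.
have [M M_big] : exists M : nat, 10 ^+ 5 <= M.+1%:R :> R.
  exists (Num.bound (10 ^+ 5 : R)).
  have := archi_boundP (exprn_ge0 5 (ler0n R 10)).
  by rewrite -natr1; lra.
(* A share [e] of the network energy pays for the frontier, through K = 2C/e, and 1 - e for the
   steps; then [r] makes the remainder at most [e]. *)
pose e : R := (10 ^+ 6)^-1; pose C : R := M.+1%:R * 12 ^+ M.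
have e0 : 0 < e by rewrite invr_gt0 exprn_gt0.
have e1 : e <= 1 / 10 ^+ 6 by rewrite mul1r.
have C0 : 0 < C by rewrite mulr_gt0 ?ltr0n ?exprn_gt0.
have K0 : 0 < 2 * C / e by apply: divr_gt0 => //; apply: mulr_gt0 => //; rewrite ltr0n.
have [r rP] := geometric_small K0 e0.
set K := 2 * C / e in K0 rP.
have kappa0 : 0 < (1 - e)^-1 by rewrite invr_gt0; lra.
have kK : (1 - e)^-1^-1 + 2 / K * C <= 1.
  have -> : 2 / K * C = e by rewrite /K; field; rewrite !gt_eqF.
  by rewrite invrK subrK.
have kappa_le : (1 - e)^-1 <= 1 + 2 / 10 ^+ 6.
  rewrite -[leLHS]mul1r ler_pdivrMr; lra.
pose N0 := #|{perm r.-bseq letter}|.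
have N0_gt0 : (0 < N0)%N by apply/card_gt0P; exists 1%g.
pose k := ((4 * M.+1 + 6) * N0)%N.
have k_gt0 : (0 < k)%N by rewrite muln_gt0 N0_gt0 addn_gt0 orbT.
exists (k * k).+2 => n nN.
(* With P = (M + 1)U, the edge budget 10P + 6U + 2l <= 3n = 9P + 3l + 3 asks for l >= P + 6U - 3.
   Taking l = P + 6U uses [k] vertices per copy besides the hub, and the remaining [rest] vertices
   become pendant too. *)
pose m := (n.-1 %/ k)%N; pose rest := (n.-1 %% k)%N.
pose U := (N0 * m)%N; pose l := ((M.+1 + 6) * U + rest)%N.
have nE : n = (3 * (M.+1 * U) + l).+1.
  rewrite -[LHS]prednK ?(leq_trans _ nN) // [in LHS](divn_eq n.-1 k) -/m -/rest.
  by rewrite /l /U /k; congr _.+1; lia.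
have mk : (k <= m)%N.
  by rewrite /m leq_divRL //; case: (n) nN => // n1; rewrite ltnS => /ltnW.
have restU : (rest <= U)%N.
  by rewrite (leq_trans (ltnW (ltn_pmod _ k_gt0))) // (leq_trans mk) // leq_pmull.
have U_gt0 : (0 < U)%N by rewrite muln_gt0 N0_gt0 (leq_trans k_gt0).
have [|G [GE Gavg]] := @hub_avg_res M r m l R n _ K kappa0 K0 kK _ nE.
  exact: leq_trans nN.
exists G; split.
  by rewrite GE -/N0 -/U nE /l; lia.
apply: le_lt_trans Gavg _; rewrite lte_fin ltr_pdivrMr; last first.
  by rewrite ltr0n (leq_trans _ nN).
have lE : l%:R = (M.+1%:R + 6) * U%:R + rest%:R :> R.
  by rewrite /l natrD natrM natrD.
rewrite -/N0 -/U nE -[(_ + l).+1%:R]natr1 natrD [(3 * _)%:R]natrM [(M.+1 * U)%:R]natrM lE.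
have := sum_tree_energy R; set s := \sum_v _ => sP.
have s0 : 0 <= s by apply: sumr_ge0 => v _; exact: tree_energy_ge0.
have sigmaP : (1 - e)^-1 * s + 3 * (K * (3 / 5) ^+ r) <= 1 + 581 / 10 ^+ 3 + 57 / 10 ^+ 5.
  by nra.
move: sigmaP; set sigma := _ + 3 * _ => sigmaP.
have restR : rest%:R <= U%:R :> R by rewrite ler_nat.
have rest0 : 0 <= rest%:R :> R by [].
have U0 : 0 < U%:R :> R by rewrite ltr0n.
have P_big : 10 ^+ 5 * U%:R <= M.+1%:R * U%:R :> R by rewrite ler_wpM2r.
have sigma_le : M.+1%:R * U%:R * sigma <=
    M.+1%:R * U%:R * (1 + 581 / 10 ^+ 3 + 57 / 10 ^+ 5).
  by rewrite ler_wpM2l // mulr_ge0.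
move: P_big sigma_le; rewrite [(_ + 6) * _]mulrDl.
(* There are about 4P vertices, whose resistances to the hub sum to about 2.58157P. The margin 4 *
   1.2908 - 2 * 2.58157 = 6/10^5 per unit of P absorbs the terms in U, since P >= 10^5 U. *)
by set P := M.+1%:R * U%:R; set PS := P * sigma => *; lra.
Qed.
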